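(* Let $X$ be a positive definite metric space with $n=\#X$ points. The similarity embedding $\varphi$ is the unique embedding of $X$ into $\mathbb{R}^{n-1}$, up to rigid transformation (isometry of $\mathbb{R}^{n-1}$), such that $$|Y| = \frac{1}{1-2R(\varphi(Y))^2}\quad\text{for all nonempty } Y\subseteq X.$$ That is, the similarity embedding of $X$ satisfies this condition, and any embedding of $X$ into $\mathbb{R}^{n-1}$ that satisfies this condition equals the similarity embedding up to an isometry of $\mathbb{R}^{n-1}$.
   Context: Metric spaces $(X,d)$ are finite and nonempty. The similarity matrix $Z=Z(X)\in\mathbb{R}^{X\times X}$ has entries $z_{ij}=e^{-d(i,j)}$. $X$ is positive definite if $Z$ is positive definite; then every nonempty subspace $Y\subseteq X$ (with the restricted metric) is positive definite. The magnitude of a positive definite metric space is $|X|=\mathbf{1}^TZ^{-1}\mathbf{1}$, with $\mathbf{1}$ the all-ones vector. A similarity embedding of a positive definite $X$ is a map $\varphi:X\to\mathbb{R}^{n-1}$ with $\|\varphi(i)-\varphi(j)\|^2=1-e^{-d(i,j)}$ for all $i,j\in X$; it exists and is unique up to isometries of $\mathbb{R}^{n-1}$. An embedding here means an injective map of the set $X$ into $\mathbb{R}^{n-1}$. For a finite nonempty set $S$ of affinely independent points, the circumradius $R(S)$ is the radius of the unique sphere, in the affine span of $S$, that passes through all points of $S$ (equal to $0$ for a single point); the condition in the claim is understood to include that $R(\varphi(Y))$ is defined. *)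

(* Defs.v *)
From HB Require Import structures.
From mathcomp Require Import all_boot all_order all_algebra finmap.
From mathcomp Require Import all_classical reals topology sequences.

Set Implicit Arguments.
Unset Strict Implicit.
Unset Printing Implicit Defensive.

Import Order.TTheory GRing.Theory Num.Theory.
Local Open Scope ring_scope.

(* Nonemptiness is not part of the structure. Subspaces of X are sets
   Y : {set X}, carrying the restriction of mdist. *)
#[short(type="finMetricType")]
HB.structure Definition FinMetric (K : numDomainType) :=
  { M of Finite M & Metric K M }.

(* The similarity matrix of Y, with Y enumerated by enum_val. *)
Definition similarity_mx (R : realType) (X : finMetricType R) (Y : {set X}) :
    'M[R]_#|Y| :=
  \matrix_(i, j) expR (- mdist (enum_val i) (enum_val j)).

Definition posdefmx (R : realType) (m : nat) (A : 'M[R]_m) : Prop :=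
  A^T = A /\ forall u : 'rV[R]_m, u != 0 -> 0 < (u *m A *m u^T) 0 0.

Definition positive_definite_space (R : realType) (X : finMetricType R) : Prop :=
  posdefmx (similarity_mx [set: X]).

(* Only meaningful when similarity_mx Y is invertible, as is the case for every
   subset Y of a positive definite space. *)
Definition magnitude (R : realType) (X : finMetricType R) (Y : {set X}) : R :=
  ((const_mx 1 : 'rV[R]_#|Y|) *m invmx (similarity_mx Y)
     *m (const_mx 1 : 'cV[R]_#|Y|)) 0 0.

(* The library norm on row vectors is the sup norm, hence this definition. *)
Definition eucl_norm (R : realType) (m : nat) (u : 'rV[R]_m) : R :=
  Num.sqrt (\sum_i u 0 i ^+ 2).

Definition eucl_isometry (R : realType) (m : nat) (f : 'rV[R]_m -> 'rV[R]_m) :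
    Prop :=
  bijective f /\ forall u v, eucl_norm (f u - f v) = eucl_norm (u - v).

Definition affinely_independent (R : realType) (m : nat)
    (S : {fset 'rV[R]_m}) : Prop :=
  forall c : 'rV[R]_m -> R,
    \sum_(p <- S) c p = 0 -> \sum_(p <- S) c p *: p = 0 ->
    forall p, p \in S -> c p = 0.

Definition in_affine_span (R : realType) (m : nat) (S : {fset 'rV[R]_m})
    (x : 'rV[R]_m) : Prop :=
  exists2 c : 'rV[R]_m -> R,
    \sum_(p <- S) c p = 1 & x = \sum_(p <- S) c p *: p.

Definition is_circumradius (R : realType) (m : nat) (S : {fset 'rV[R]_m})
    (r : R) : Prop :=
  exists2 c : 'rV[R]_m,
    in_affine_span S c & forall p, p \in S -> eucl_norm (p - c) = r.

(* When S is nonempty and affinely independent there is exactly one r such that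
   is_circumradius S r; the default value 0 is irrelevant in that case. *)
Definition circumradius (R : realType) (m : nat) (S : {fset 'rV[R]_m}) : R :=
  xget 0 [set r | is_circumradius S r]%classic.

Definition is_similarity_embedding (R : realType) (X : finMetricType R)
    (phi : X -> 'rV[R]_(#|X|.-1)) : Prop :=
  forall i j : X, eucl_norm (phi i - phi j) ^+ 2 = 1 - expR (- mdist i j).

(* Affine independence says that the circumradius is defined. The denominator
   cannot vanish if X is positive definite: division by 0 yields 0, whereas
   every magnitude in the equation is then positive. *)
Definition magnitude_circumradius_formula (R : realType) (X : finMetricType R)
    (phi : X -> 'rV[R]_(#|X|.-1)) : Prop :=
  forall Y : {set X}, Y != finset.set0 ->
    affinely_independent [fset phi y | y in Y]%fset /\
    magnitude Y = 1 / (1 - 2 * circumradius [fset phi y | y in Y]%fset ^+ 2).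

(* Main.v *)
Require Import Defs.
From mathcomp Require Import all_boot all_order all_algebra finmap.
From mathcomp Require Import boolp classical_sets reals topology sequences.
From mathcomp Require Import exp ring lra.

(** Write [Z] for the similarity matrix, [z x y] for its entries and [p x] for
    the image of the point [x].  Two facts carry the theorem.

    A similarity embedding turns [Z] into Euclidean geometry: since
    [|p x - p y|^2 = 1 - z x y], combinations of the points whose coefficients
    sum to 0 have inner product [a^T Z b / 2] ([dot_zero_sum]).  Hence the points
    are affinely independent when [Z] is positive definite, and the point with
    barycentric coordinates [t] is at squared distance
    [1/2 - (Z t)_x + t^T Z t / 2] from [p x] ([sqdist_barycenter]).  For [t]
    supported in [Y], it is equidistant from the points of [Y] exactly when
    [Z t] is constant on [Y], that is, when [t] is the weighting of [Y] (the
    solution [w], supported in [Y], of [Z w = 1] on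
    [Y]) divided by its sum [|Y|].  Then [Z t] is constantly [1/|Y|], so the
    squared circumradius is [(1 - 1/|Y|)/2] ([circumradius_embedding]), which is
    the formula to prove.

    Conversely the formula for two-point subspaces already determines the
    embedding: the circumradius of a pair is half the distance between its
    points ([circumradius_pair]), so any two embeddings satisfying the formula
    have the same pairwise distances ([formula_dist]).

    What remains concerns the matrix of inner products of the [p x - p x0] with
    [x != x0].  The entries of [Z] determine it, and it is positive definite of
    order [n - 1] ([based_gram_mx_posdef]).  Factoring it as [L L^T] gives the
    existence of a similarity embedding in dimension [n - 1]
    ([similarity_embedding_exists]); two such factorizations with invertible
    factors differ by an orthogonal matrix, which gives uniqueness up to isometry
    ([similarity_embeddings_isometric]). *)

Set Implicit Arguments.
Unset Strict Implicit.
Unset Printing Implicit Defensive.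
Import Order.TTheory GRing.Theory Num.Theory.
Local Open Scope ring_scope.

(** * Euclidean inner product on row vectors *)

Section Dot.
Variables (R : realType) (m : nat).
Implicit Types (u v w : 'rV[R]_m).

Definition dot u v : R := (u *m v^T) 0 0.

Lemma dotE u v : dot u v = \sum_k u 0 k * v 0 k.
Proof. by rewrite /dot mxE; apply: eq_bigr => k _; rewrite mxE. Qed.

Lemma dotC u v : dot u v = dot v u.
Proof. by rewrite !dotE; apply: eq_bigr => k _; rewrite mulrC. Qed.

Lemma dotBl u v w : dot (u - v) w = dot u w - dot v w.
Proof. by rewrite /dot mulmxBl !mxE. Qed.

Lemma dotBr u v w : dot u (v - w) = dot u v - dot u w.
Proof. by rewrite !(dotC u) dotBl. Qed.

Lemma dotZ (k : R) u : dot (k *: u) (k *: u) = k ^+ 2 * dot u u.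
Proof. by rewrite /dot linearZ /= -scalemxAl -scalemxAr !mxE; ring. Qed.

Lemma dot_suml (I : finType) (a : I -> R) (p : I -> 'rV[R]_m) w :
  dot (\sum_i a i *: p i) w = \sum_i a i * dot (p i) w.
Proof.
rewrite /dot mulmx_suml summxE; apply: eq_bigr => i _.
by rewrite -scalemxAl mxE.
Qed.

Lemma dot_sumr (I : finType) (a : I -> R) (p : I -> 'rV[R]_m) w :
  dot w (\sum_i a i *: p i) = \sum_i a i * dot w (p i).
Proof. by rewrite dotC dot_suml; apply: eq_bigr => i _; rewrite dotC. Qed.

Lemma sqr_eucl_norm u : eucl_norm u ^+ 2 = dot u u.
Proof.
rewrite dotE sqr_sqrtr; first by apply: eq_bigr => k _.
by apply: sumr_ge0 => k _; rewrite sqr_ge0.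
Qed.

Lemma dot_eq0 u : dot u u = 0 -> u = 0.
Proof.
rewrite dotE => /psumr_eq0P u0; apply/rowP => k; rewrite mxE; apply/eqP.
by rewrite -sqrf_eq0 expr2 u0// => i _; rewrite -expr2 sqr_ge0.
Qed.

Lemma eucl_norm_ge0 u : 0 <= eucl_norm u.
Proof. exact: sqrtr_ge0. Qed.

Lemma eucl_norm_eqP u v : eucl_norm u = eucl_norm v <-> dot u u = dot v v.
Proof.
rewrite -!sqr_eucl_norm; split=> [->//|/eqP].
by rewrite eqrXn2 ?eucl_norm_ge0// => /eqP.
Qed.

Lemma polarization u v w :
  dot (u - w) (v - w) =
  (dot (u - w) (u - w) + dot (v - w) (v - w) - dot (u - v) (u - v)) / 2.
Proof.
rewrite !(dotBl, dotBr) (dotC w u) (dotC w v) (dotC v u); lra.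
Qed.

End Dot.

(** * Cholesky factorization *)

Section PosDef.
Variable R : realType.

Lemma posdefmx_unit n (A : 'M[R]_n) : posdefmx A -> A \in unitmx.
Proof.
move=> [_ Apos]; rewrite -row_free_unit; apply: inj_row_free => v vA0.
by apply/eqP; apply: contraT => /Apos; rewrite vA0 mul0mx mxE ltxx.
Qed.

(** By induction on the order: the Schur complement of the top left entry is
    again positive definite. *)
Lemma cholesky n (A : 'M[R]_n) : posdefmx A -> exists L : 'M_n, A = L *m L^T.
Proof.
elim: n A => [|n IHn] A; first by exists 0; apply/matrixP => - [].
rewrite -[n.+1]/(1 + n)%N in A *; move=> [Asym Apos].
set a := A 0 0; set b : 'rV[R]_n := ursubmx A.
have defA : A = block_mx a%:M b b^T (drsubmx A).
  rewrite -[LHS]submxK; congr block_mx.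
    apply/matrixP => i j; rewrite !ord1 !mxE eqxx mulr1n.
    by congr (A _ _); apply/val_inj.
  by rewrite /b trmx_ursub Asym.
have a_gt0 : 0 < a.
  have := Apos (delta_mx 0 0); rewrite trmx_delta -rowE -colE !mxE; apply.
  by apply/eqP => /matrixP/(_ 0 0)/eqP; rewrite !mxE !eqxx oner_eq0.
have a0 : a != 0 by rewrite gt_eqF.
set C := drsubmx A - a^-1 *: (b^T *m b).
have Csym : C^T = C.
  by rewrite /C linearB linearZ /= trmx_mul trmxK trmx_drsub Asym.
have /IHn[L defC] : posdefmx C.
  split=> // v v0.
  (* The first coordinate of [u] minimizes the form when the others are those
     of [v]; the minimum is the value of the Schur complement at [v]. *)
  pose u : 'rV[R]_(1 + n) := row_mx (- a^-1 *: (v *m b^T)) v.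
  have u0 : u != 0.
    by apply: contra v0 => /eqP/(congr1 rsubmx); rewrite row_mxKr linear0 => ->.
  have := Apos u u0; rewrite defA mul_row_block tr_row_mx mul_row_col.
  rewrite mul_mx_scalar scalerA mulrN divff// scaleN1r addNr mul0mx add0r.
  by rewrite /C mulmxBr -scalemxAl -scalemxAr mulmxA addrC scaleNr.
have sqa : Num.sqrt a * Num.sqrt a = a by rewrite -expr2 sqr_sqrtr// ltW.
have sa0 : Num.sqrt a != 0 by rewrite gt_eqF// sqrtr_gt0.
exists (block_mx (Num.sqrt a)%:M 0 ((Num.sqrt a)^-1 *: b^T) L).
rewrite tr_block_mx mulmx_block !trmx0 !mul0mx !mulmx0 !addr0 tr_scalar_mx.
rewrite linearZ /= trmxK {1}defA -scalar_mxM sqa.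
rewrite mul_scalar_mx mul_mx_scalar !scalerA divff// !scale1r.
rewrite -scalemxAl -scalemxAr scalerA -invfM sqa.
by rewrite -defC /C addrC subrK.
Qed.

End PosDef.

(** * Isometries between congruent frames *)

Section Congruence.
Variable R : realType.

(** The matrix [A^-1 B] is orthogonal because [A] and [B] have the same Gram
    matrix, and it sends the rows of [A] to those of [B]. *)
Lemma congruent_frames_isometry m (A B : 'M[R]_m) (a b : 'rV[R]_m) :
  A \in unitmx -> A *m A^T = B *m B^T ->
  exists2 f, eucl_isometry f &
    f a = b /\ forall k, f (a + row k A) = b + row k B.
Proof.
move=> Au AB; pose Q := invmx A *m B.
have QQt : Q *m Q^T = 1%:M.
  rewrite /Q trmx_mul mulmxA -(mulmxA _ B) -AB mulmxA mulVmx// mul1mx.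
  by rewrite trmx_inv mulmxV// unitmx_tr.
have QtQ : Q^T *m Q = 1%:M by apply: mulmx1C.
exists (fun v => b + (v - a) *m Q).
  split.
    exists (fun v => a + (v - b) *m Q^T) => v.
      by rewrite [b + _]addrC addrK -mulmxA QQt mulmx1 addrC subrK.
    by rewrite [a + _]addrC addrK -mulmxA QtQ mulmx1 addrC subrK.
  move=> u v; apply/eucl_norm_eqP.
  rewrite opprD addrACA subrr add0r -mulmxBl opprB addrA subrK.
  by rewrite /dot trmx_mul mulmxA -(mulmxA _ Q) QQt mulmx1.
split=> [|k]; first by rewrite subrr mul0mx addr0.
by rewrite [a + _]addrC addrK -row_mul /Q mulKVmx.
Qed.

End Congruence.

(** * Similarity form, weightings and magnitude *)

Section Similarity.
Variables (R : realType) (X : finMetricType R).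
Implicit Types (x y z : X) (Y : {set X}) (a b c t : X -> R).

Definition sim x y : R := expR (- mdist x y).

Lemma simC x y : sim x y = sim y x.
Proof. by rewrite /sim metric_sym. Qed.

Lemma simxx x : sim x x = 1.
Proof. by rewrite /sim mdistxx oppr0 expR0. Qed.

(** [simact] is [Z a] and [simform] is [a^T Z b].  They are indexed by the points
    of [X] rather than by an enumeration, so that a vector indexed by a subset
    becomes a function vanishing outside it. *)
Definition simact a x : R := \sum_y sim x y * a y.
Definition simform a b : R := \sum_x a x * simact b x.

Lemma simact_subZ a b (k : R) x :
  simact (fun y => a y - k * b y) x = simact a x - k * simact b x.
Proof.
rewrite /simact mulr_sumr -sumrB; apply: eq_bigr => y _; ring.
Qed.

Lemma simform_sym a b : simform a b = simform b a.
Proof.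
rewrite /simform /simact.
under eq_bigr do rewrite mulr_sumr; rewrite exchange_big /=.
apply: eq_bigr => x _; rewrite mulr_sumr; apply: eq_bigr => y _.
by rewrite simC; ring.
Qed.

Lemma simform_sub a b :
  simform (fun y => a y - b y) (fun y => a y - b y) =
  simform a a - 2 * simform a b + simform b b.
Proof.
transitivity (simform a a - simform a b - simform b a + simform b b).
  rewrite /simform -!sumrB -big_split /=; apply: eq_bigr => x _.
  have -> : simact (fun y => a y - b y) x = simact a x - simact b x.
    by rewrite /simact -sumrB; apply: eq_bigr => y _; rewrite mulrBr.
  ring.
by rewrite (simform_sym b a); ring.
Qed.

Definition extend Y (u : 'rV[R]_#|Y|) x : R :=
  \sum_j u 0 j * (enum_val j == x)%:R.

Lemma sum_extend Y (u : 'rV[R]_#|Y|) f :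
  \sum_x f x * extend u x = \sum_j f (enum_val j) * u 0 j.
Proof.
rewrite /extend; under eq_bigr do rewrite mulr_sumr.
rewrite exchange_big /=; apply: eq_bigr => j _.
rewrite (bigD1 (enum_val j))//= eqxx mulr1 big1 ?addr0// => x xj.
by rewrite eq_sym (negbTE xj) !mulr0.
Qed.

Lemma extend_val Y (u : 'rV[R]_#|Y|) j : extend u (enum_val j) = u 0 j.
Proof.
rewrite /extend (bigD1 j)//= eqxx mulr1 big1 ?addr0// => k kj.
by rewrite (inj_eq enum_val_inj) (negbTE kj) mulr0.
Qed.

Lemma extend_out Y (u : 'rV[R]_#|Y|) x : x \notin Y -> extend u x = 0.
Proof.
move=> xY; apply: big1 => j _; case: eqP => [jx|]; last by rewrite mulr0.
by rewrite -jx enum_valP in xY.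
Qed.

Lemma simact_extend Y (u : 'rV[R]_#|Y|) j :
  simact (extend u) (enum_val j) = (u *m similarity_mx Y) 0 j.
Proof.
rewrite /simact sum_extend mxE; apply: eq_bigr => k _.
by rewrite mxE -/(sim _ _) simC mulrC.
Qed.

Lemma simform_extend Y (u : 'rV[R]_#|Y|) :
  simform (extend u) (extend u) = (u *m similarity_mx Y *m u^T) 0 0.
Proof.
rewrite /simform; under eq_bigr do rewrite mulrC.
rewrite sum_extend -/(dot _ _) dotE; apply: eq_bigr => j _.
by rewrite simact_extend.
Qed.

Hypothesis X_posdef : positive_definite_space X.

Lemma simform_gt0 a x : a x != 0 -> 0 < simform a a.
Proof.
move=> ax0; pose u : 'rV[R]_#|[set: X]%SET| := \row_j a (enum_val j).
have eua : extend u = a.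
  apply/funext => y; have yT : y \in [set: X]%SET by rewrite inE.
  by rewrite -(enum_rankK_in yT yT) extend_val mxE.
rewrite -eua simform_extend; apply: X_posdef.2.
apply: contra ax0 => /eqP u0; rewrite -eua u0 /extend big1// => j _.
by rewrite mxE mul0r.
Qed.

Lemma simform_eq0 a : simform a a = 0 -> forall x, a x = 0.
Proof.
by move=> a0 x; apply/eqP; apply: contraT => /simform_gt0; rewrite a0 ltxx.
Qed.

(** Injectivity of the principal submatrix of [Z] on [Y]: the two conditions make
    every term of [a^T Z a] vanish. *)
Lemma simact_eq0 Y a : (forall x, x \notin Y -> a x = 0) ->
  (forall x, x \in Y -> simact a x = 0) -> forall x, a x = 0.
Proof.
move=> aY Za; apply: simform_eq0; apply: big1 => x _.
by have [/Za->|/aY->] := boolP (x \in Y); rewrite ?mulr0 ?mul0r.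
Qed.

Lemma similarity_mx_unit Y : similarity_mx Y \in unitmx.
Proof.
rewrite -row_free_unit; apply: inj_row_free => u uZ0.
apply/rowP => j; rewrite mxE -extend_val.
apply: (@simact_eq0 Y); first exact: extend_out.
by move=> x xY; rewrite -(enum_rankK_in xY xY) simact_extend uZ0 mxE.
Qed.

Definition weighting Y a :=
  (forall x, x \notin Y -> a x = 0) /\ (forall x, x \in Y -> simact a x = 1).

Lemma weighting_exists Y :
  exists2 w, weighting Y w & magnitude Y = \sum_x w x.
Proof.
pose u : 'rV[R]_#|Y| := const_mx 1 *m invmx (similarity_mx Y).
exists (extend u).
  split=> [|x xY]; first exact: extend_out.
  rewrite -(enum_rankK_in xY xY) simact_extend.
  by rewrite mulmxKV ?similarity_mx_unit ?mxE.
rewrite /magnitude -/u mxE.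
transitivity (\sum_x 1 * extend u x); last by under eq_bigr do rewrite mul1r.
by rewrite sum_extend; apply: eq_bigr => j _; rewrite [const_mx _ _ _]mxE mulrC.
Qed.

Lemma weighting_proportional Y w a (k : R) : weighting Y w ->
  (forall x, x \notin Y -> a x = 0) -> (forall x, x \in Y -> simact a x = k) ->
  forall x, a x = k * w x.
Proof.
move=> [wY Zw] aY Za x; apply/eqP; rewrite -subr_eq0; apply/eqP.
apply: (@simact_eq0 Y (fun x => a x - k * w x)) => {}x xY.
  by rewrite aY// wY// mulr0 subrr.
by rewrite simact_subZ Za// Zw// mulr1 subrr.
Qed.

Lemma simform_supp Y a b (k : R) : (forall x, x \notin Y -> a x = 0) ->
  (forall x, x \in Y -> simact b x = k) -> simform a b = (\sum_x a x) * k.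
Proof.
move=> aY Zb; rewrite /simform mulr_suml; apply: eq_bigr => x _.
by have [/Zb->|/aY->] := boolP (x \in Y); rewrite ?mul0r.
Qed.

(** If [w] is a weighting of [Y], then [|Y| = w^T Z w]. *)
Lemma magnitude_gt0 Y : Y != finset.set0 -> 0 < magnitude Y.
Proof.
case/set0Pn => x xY; have [w [wY Zw] ->] := weighting_exists Y.
rewrite -[ltRHS]mulr1 -(simform_supp wY Zw).
suff [y wy0] : exists y, w y != 0 by exact: simform_gt0 wy0.
apply: contrapT => nw; have /eqP := Zw _ xY.
rewrite /simact big1 => [|y _]; first by rewrite eq_sym oner_eq0.
have [->|wy] := eqVneq (w y) 0; first by rewrite mulr0.
by case: nw; exists y.
Qed.

End Similarity.

(** * Affine combinations of an indexed family of points *)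

Section FsetImage.
Variables (R : realType) (X : finType) (m : nat) (phi : X -> 'rV[R]_m).
Hypothesis phi_inj : injective phi.
Implicit Types (Y : {set X}) (t : X -> R).
Local Notation img Y := [fset phi y | y in Y]%fset.

Lemma big_fset_image (V : nmodType) Y (F : 'rV[R]_m -> V) :
  \sum_(p <- img Y) F p = \sum_(y in Y) F (phi y).
Proof.
rewrite big_imfset /=; last by move=> x y _ _; exact: phi_inj.
exact: big_enum.
Qed.

Lemma affinely_independent_image Y :
  (forall t, (forall x, x \notin Y -> t x = 0) ->
    \sum_x t x = 0 -> \sum_x t x *: phi x = 0 -> forall x, t x = 0) ->
  affinely_independent (img Y).
Proof.
move=> indep c; rewrite !big_fset_image => c0 cphi0 _ /imfsetP[x /= xY ->].
have := indep (fun x => if x \in Y then c (phi x) else 0) _ _ _ x.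
rewrite xY; apply.
- by move=> y /negbTE ->.
- by rewrite -big_mkcond.
rewrite -[RHS]cphi0 [RHS]big_mkcond; apply: eq_bigr => y _.
by case: ifP; rewrite ?scale0r.
Qed.

Lemma in_affine_span_imageP Y v :
  in_affine_span (img Y) v <->
  exists t, [/\ forall x, x \notin Y -> t x = 0, \sum_x t x = 1
              & v = \sum_x t x *: phi x].
Proof.
split=> [[c c1 ->]|[t [tY t1 ->]]].
  exists (fun x => if x \in Y then c (phi x) else 0); split.
  - by move=> x /negbTE ->.
  - by rewrite -big_mkcond -c1 big_fset_image.
  rewrite big_fset_image [LHS]big_mkcond; apply: eq_bigr => x _.
  by case: ifP; rewrite ?scale0r.
pose c p : R := \sum_x t x * (phi x == p)%:R.
have cE x : c (phi x) = t x.
  rewrite /c (bigD1 x)//= eqxx mulr1 big1 ?addr0// => y yx.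
  by rewrite (inj_eq phi_inj) (negbTE yx) mulr0.
exists c; rewrite big_fset_image.
  rewrite -t1 big_mkcond; apply: eq_bigr => x _; rewrite cE.
  by case: ifPn => // /tY ->.
rewrite [RHS]big_mkcond; apply: eq_bigr => x _; rewrite cE.
by case: ifPn => // /tY ->; rewrite scale0r.
Qed.

End FsetImage.

(** * Circumradius *)

Section Circumradius.
Variables (R : realType) (m : nat).

Lemma circumradiusP (S : {fset 'rV[R]_m}) :
  (exists r, is_circumradius S r) -> is_circumradius S (circumradius S).
Proof. exact: (@xgetPex _ _ [set r | is_circumradius S r]%classic). Qed.

(** A point [t p + (1 - t) q] of a line is equidistant from [p] and [q] only if
    [(1 - t)^2 = t^2], which makes it the midpoint. *)
Lemma circumradius_pair (X : finType) (phi : X -> 'rV[R]_m) x y :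
  injective phi -> x != y ->
  circumradius [fset phi z | z in [set x; y]%SET]%fset
    = eucl_norm (phi x - phi y) / 2.
Proof.
move=> phi_inj xy; set S := [fset _ | _ in _]%fset; set d := phi x - phi y.
have sum2 (V : nmodType) (F : X -> V) :
    (forall z, z \notin [set x; y]%SET -> F z = 0) -> \sum_z F z = F x + F y.
  move=> F0; rewrite (bigD1 x)//= (bigD1 y) 1?eq_sym//= big1 ?addr0//.
  by move=> z /andP[zx zy]; apply: F0; rewrite !inE negb_or zx.
have xS : phi x \in S by apply/imfsetP; exists x; rewrite //= !inE eqxx.
have yS : phi y \in S by apply/imfsetP; exists y; rewrite //= !inE eqxx orbT.
have /circumradiusP[c /(in_affine_span_imageP phi_inj)] :
    exists r, is_circumradius S r.
  exists (eucl_norm (2^-1 *: d)); exists (2^-1 *: (phi x + phi y)).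
    apply/(in_affine_span_imageP phi_inj).
    exists (fun z => if z \in [set x; y]%SET then 2^-1 else 0); split.
    - by move=> z /negbTE ->.
    - rewrite sum2 => [|z /negbTE ->//]; rewrite !inE !eqxx orbT/=; lra.
    - rewrite sum2 => [|z /negbTE ->]; last by rewrite scale0r.
      by rewrite !inE !eqxx orbT/= scalerDr.
  move=> p /imfsetP[z /=]; rewrite !inE => /orP[]/eqP -> ->;
    apply/eucl_norm_eqP; rewrite !dotE; apply: eq_bigr => k _; rewrite !mxE;
    by field.
move=> [t [tS t1 ->]] tr.
have := tr _ xS; have := tr _ yS.
rewrite sum2 => [|z /tS->]; last by rewrite scale0r.
have ty : t y = 1 - t x by rewrite -t1 sum2// addrAC subrr add0r.
have -> : phi x - (t x *: phi x + t y *: phi y) = t y *: d.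
  by rewrite /d ty; apply/rowP => k; rewrite !mxE; ring.
have -> : phi y - (t x *: phi x + t y *: phi y) = - t x *: d.
  by rewrite /d ty; apply/rowP => k; rewrite !mxE; ring.
move=> rx ry.
have d0 : dot d d != 0.
  apply: contra xy => /eqP/dot_eq0/eqP; rewrite subr_eq0 => /eqP/phi_inj ->.
  exact: eqxx.
have : dot (- t x *: d) (- t x *: d) = dot (t y *: d) (t y *: d).
  by apply/eucl_norm_eqP; rewrite rx ry.
rewrite !dotZ => /(mulIf d0) tt.
have tyE : t y = 2^-1 by nra.
apply/eqP; rewrite -(@eqrXn2 _ 2)// ?eucl_norm_ge0//; last first.
- by rewrite divr_ge0// eucl_norm_ge0.
- by rewrite -ry eucl_norm_ge0.
by rewrite -ry expr_div_n !sqr_eucl_norm dotZ tyE; apply/eqP; field.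
Qed.

End Circumradius.

(** * Geometry of a similarity embedding *)

Section Embedding.
Variables (R : realType) (X : finMetricType R) (m : nat).
Variable (phi : X -> 'rV[R]_m).
Hypothesis phi_emb : forall x y, eucl_norm (phi x - phi y) ^+ 2 = 1 - sim x y.
Implicit Types (x y z : X) (Y : {set X}) (a b c t : X -> R).

Lemma embedding_inj : injective phi.
Proof.
move=> x y pxy; apply: mdist_positivity.
have := phi_emb x y; rewrite pxy subrr sqr_eucl_norm.
rewrite /dot mul0mx mxE => /esym/eqP; rewrite subr_eq0 => /eqP/esym.
by rewrite /sim -expR0 => /expR_inj/eqP; rewrite oppr_eq0 => /eqP.
Qed.

(** Each inner product [phi x . phi y] is [sim x y / 2] up to a term depending on
    [x] only and one depending on [y] only; combinations whose coefficients sum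
    to 0 do not see these two terms. *)
Lemma dot_zero_sum a b : \sum_x a x = 0 -> \sum_x b x = 0 ->
  dot (\sum_x a x *: phi x) (\sum_x b x *: phi x) = simform a b / 2.
Proof.
move=> a0 b0; pose n x := dot (phi x) (phi x).
have dE x y : dot (phi x) (phi y) = (n x + n y - 1 + sim x y) / 2.
  have := phi_emb x y.
  by rewrite sqr_eucl_norm !(dotBl, dotBr) (dotC (phi y)) -!/(n _); lra.
rewrite dot_suml.
transitivity (\sum_x (a x * ((\sum_y b y * n y) / 2) + a x * simact b x / 2)).
  apply: eq_bigr => x _; rewrite -mulrA -mulrDr; congr (_ * _); rewrite dot_sumr.
  transitivity (\sum_y (b y * ((n x - 1) / 2) + (b y * n y) / 2
                        + (sim x y * b y) / 2)).
    by apply: eq_bigr => y _; rewrite dE; lra.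
  by rewrite !big_split /= -!mulr_suml b0 mul0r add0r.
by rewrite big_split /= -!mulr_suml a0 mul0r add0r.
Qed.

(** The vector from the barycenter to [phi x] is the combination with
    coefficients [delta_x - t], of sum 0. *)
Lemma sqdist_barycenter t x : \sum_y t y = 1 ->
  eucl_norm (phi x - \sum_y t y *: phi y) ^+ 2 =
  (1 - 2 * simact t x + simform t t) / 2.
Proof.
move=> t1; pose d y : R := (y == x)%:R.
have sumd (V : lmodType R) (F : X -> V) : \sum_y d y *: F y = F x.
  rewrite (bigD1 x)//= /d eqxx scale1r big1 ?addr0// => y /negbTE ->.
  by rewrite scale0r.
have sumdr (F : X -> R) : \sum_y d y * F y = F x by exact: (sumd R^o).
have -> : phi x - \sum_y t y *: phi y = \sum_y (d y - t y) *: phi y.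
  by under [RHS]eq_bigr do rewrite scalerBl; rewrite sumrB sumd.
have dt0 : \sum_y (d y - t y) = 0.
  rewrite sumrB t1; under eq_bigr do rewrite -[d _]mulr1.
  by rewrite sumdr subrr.
rewrite sqr_eucl_norm dot_zero_sum// simform_sub.
rewrite ![simform d _]sumdr /simact.
by under eq_bigr do rewrite mulrC; rewrite sumdr simxx.
Qed.

Hypothesis X_posdef : positive_definite_space X.

Lemma embedding_affinely_independent Y :
  affinely_independent [fset phi y | y in Y]%fset.
Proof.
apply: (affinely_independent_image embedding_inj) => t _ t0 tphi0.
apply: (simform_eq0 X_posdef).
have := dot_zero_sum t0 t0; rewrite tphi0 /dot mul0mx mxE; lra.
Qed.

(** The barycenter with coordinates [t] is equidistant from the points of [Y] if
    and only if [Z t] is constant on [Y]; the constant is then [1/|Y|]. *)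
Lemma circumradius_embedding Y : Y != finset.set0 ->
  circumradius [fset phi y | y in Y]%fset ^+ 2 = (1 - (magnitude Y)^-1) / 2.
Proof.
move=> Y0; have m_gt0 := magnitude_gt0 X_posdef Y0.
have m0 : magnitude Y != 0 by rewrite gt_eqF.
have [w wY wm] := weighting_exists X_posdef Y.
case/set0Pn: Y0 => x0 x0Y; set S := [fset _ | _ in _]%fset.
have x0S : phi x0 \in S by apply/imfsetP; exists x0.
have dist t k : (forall x, x \notin Y -> t x = 0) -> \sum_x t x = 1 ->
    (forall x, x \in Y -> simact t x = k) ->
    forall x, x \in Y ->
      eucl_norm (phi x - \sum_y t y *: phi y) ^+ 2 = (1 - k) / 2.
  move=> tY t1 Zt x xY; rewrite sqdist_barycenter// (simform_supp tY Zt) t1 Zt//.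
  by rewrite mul1r; lra.
have kE t k : (forall x, x \notin Y -> t x = 0) -> \sum_x t x = 1 ->
    (forall x, x \in Y -> simact t x = k) -> k = (magnitude Y)^-1.
  move=> tY t1 Zt; apply: (mulIf m0); rewrite mulVf// wm mulr_sumr -t1.
  by apply: eq_bigr => x _; rewrite (weighting_proportional X_posdef wY tY Zt).
(* The normalized weighting gives a circumcenter. *)
have /circumradiusP[c /(in_affine_span_imageP embedding_inj)] :
    exists r, is_circumradius S r.
  pose t x := (magnitude Y)^-1 * w x; pose c := \sum_y t y *: phi y.
  have tY x : x \notin Y -> t x = 0 by move=> /wY.1; rewrite /t => ->; rewrite mulr0.
  have t1 : \sum_x t x = 1 by rewrite -mulr_sumr -wm mulVf.
  have Zt x : x \in Y -> simact t x = (magnitude Y)^-1.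
    move=> xY; rewrite -[RHS]mulr1 -(wY.2 x xY) /simact mulr_sumr.
    by apply: eq_bigr => y _; rewrite mulrCA.
  exists (eucl_norm (phi x0 - c)); exists c.
    by apply/(in_affine_span_imageP embedding_inj); exists t.
  move=> p /imfsetP[x /= xY ->]; apply/eucl_norm_eqP.
  by rewrite -!sqr_eucl_norm !(dist _ _ tY t1 Zt).
move=> [t [tY t1 cE]] rE; set r := circumradius S in rE *.
have Zt x : x \in Y -> simact t x = (1 + simform t t) / 2 - r ^+ 2.
  move=> xY; have xS : phi x \in S by apply/imfsetP; exists x.
  by rewrite -(rE _ xS) cE sqdist_barycenter//; lra.
by rewrite -(kE _ _ tY t1 Zt) -{1}(rE _ x0S) cE (dist _ _ tY t1 Zt).
Qed.

End Embedding.

(** * The based Gram matrix: existence and uniqueness *)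

Section Simplex.
Variables (R : realType) (X : finMetricType R) (x0 : X).
Implicit Types (x y : X).

(** The inner product of [phi x - phi x0] and [phi y - phi x0] in any similarity
    embedding [phi], in terms of the metric alone. *)
Definition based_gram x y : R := (sim x y - sim x x0 - sim x0 y + 1) / 2.

(** The points other than [x0] are indexed by the coordinates of the target
    space, so that their images form square matrices. *)
Definition vertex (k : 'I_#|X|.-1) : X :=
  enum_val (cast_ord (esym (cardsC1 x0)) k).

Lemma vertex_inj : injective vertex.
Proof. by move=> k l /enum_val_inj/cast_ord_inj. Qed.

Lemma vertex_neq k : vertex k != x0.
Proof. by have := enum_valP (cast_ord (esym (cardsC1 x0)) k); rewrite !inE. Qed.

Lemma vertexP x : x = x0 \/ exists k, x = vertex k.
Proof.
have [->|xx0] := eqVneq x x0; first by left.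
have xC : x \in [set~ x0] by rewrite !inE.
right; exists (cast_ord (cardsC1 x0) (enum_rank_in xC x)).
by rewrite /vertex cast_ordK enum_rankK_in.
Qed.

Definition based_gram_mx : 'M[R]_#|X|.-1 :=
  \matrix_(k, l) based_gram (vertex k) (vertex l).

Lemma based_gramC x y : based_gram x y = based_gram y x.
Proof. by rewrite /based_gram (simC x y) (simC x x0) (simC x0 y); ring. Qed.

Lemma based_gramx0 x : based_gram x x0 = 0.
Proof. by rewrite /based_gram simxx; ring. Qed.

(** The quadratic form of this matrix at [u] is half the similarity form at the sum of the
    [u_k (delta_(vertex k) - delta_x0)], a function on [X] whose value at
    [vertex k] is [u_k]. *)
Lemma based_gram_mx_posdef :
  positive_definite_space X -> posdefmx based_gram_mx.
Proof.
move=> X_posdef; split=> [|u u0].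
  by apply/matrixP => k l; rewrite !mxE based_gramC.
pose a x := \sum_k u 0 k * ((vertex k == x)%:R - (x0 == x)%:R).
have suma (f : X -> R) :
    \sum_x f x * a x = \sum_k u 0 k * (f (vertex k) - f x0).
  have delta z : \sum_x f x * (z == x)%:R = f z.
    rewrite (bigD1 z)//= eqxx mulr1 big1 ?addr0// => x xz.
    by rewrite eq_sym (negbTE xz) mulr0.
  rewrite /a; under eq_bigr do rewrite mulr_sumr.
  rewrite exchange_big /=; apply: eq_bigr => k _.
  rewrite -[in RHS]delta -[f x0 in RHS]delta -sumrB mulr_sumr.
  by apply: eq_bigr => x _; ring.
have aE : (u *m based_gram_mx *m u^T) 0 0 = simform a a / 2.
  rewrite -/(dot _ _) dotE /simform; under [in RHS]eq_bigr do rewrite mulrC.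
  rewrite suma mulr_suml; apply: eq_bigr => k _.
  rewrite mxE /simact !suma mulrC -mulrA -sumrB; congr (_ * _).
  rewrite mulr_suml; apply: eq_bigr => l _.
  by rewrite mxE based_gramC /based_gram simxx (simC x0); lra.
have [k uk0] : exists k, u 0 k != 0 by apply/rV0Pn.
rewrite aE divr_gt0//; apply: (@simform_gt0 _ _ X_posdef _ (vertex k)).
rewrite /a (bigD1 k)//= eqxx (eq_sym x0) (negbTE (vertex_neq k)) subr0 mulr1.
rewrite big1 ?addr0// => l lk.
rewrite (inj_eq vertex_inj) (negbTE lk).
by rewrite subrr mulr0.
Qed.

Lemma embedding_based_gram m (phi : X -> 'rV[R]_m) x y :
  (forall x y, eucl_norm (phi x - phi y) ^+ 2 = 1 - sim x y) ->
  dot (phi x - phi x0) (phi y - phi x0) = based_gram x y.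
Proof.
move=> emb; rewrite polarization -!sqr_eucl_norm !emb /based_gram (simC x0); lra.
Qed.

(** The rows of a Cholesky factor are the images of the points other than [x0],
    which goes to the origin. *)
Lemma similarity_embedding_exists : positive_definite_space X ->
  exists phi : X -> 'rV[R]_(#|X|.-1), is_similarity_embedding phi.
Proof.
move=> /based_gram_mx_posdef/cholesky[L GL].
pose phi x : 'rV[R]_(#|X|.-1) := \sum_k (vertex k == x)%:R *: row k L.
have phi0 : phi x0 = 0.
  by apply: big1 => k _; rewrite (negbTE (vertex_neq k)) scale0r.
have phiv k : phi (vertex k) = row k L.
  rewrite /phi (bigD1 k)//= eqxx scale1r big1 ?addr0// => l lk.
  by rewrite (inj_eq vertex_inj) (negbTE lk) scale0r.
have dphi x y : dot (phi x) (phi y) = based_gram x y.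
  have [->|[k ->]] := vertexP x.
    by rewrite phi0 based_gramC based_gramx0 /dot mul0mx mxE.
  have [->|[l ->]] := vertexP y.
    by rewrite phi0 based_gramx0 dotC /dot mul0mx mxE.
  have := congr1 (fun A : 'M_ _ => A k l) GL; rewrite mxE => ->.
  by rewrite !phiv dotE mxE; apply: eq_bigr => i _; rewrite !mxE.
exists phi => x y; rewrite sqr_eucl_norm !(dotBl, dotBr) !dphi.
by rewrite /based_gram !simxx -/(sim x y) (simC y x) (simC x0 x) (simC x0 y); lra.
Qed.

(** Based at [x0], both embeddings have the same Gram matrix; as it is
    invertible, the frame [phi x - phi x0] is a basis. *)
Lemma similarity_embeddings_isometric (phi psi : X -> 'rV[R]_(#|X|.-1)) :
  positive_definite_space X ->
  is_similarity_embedding phi -> is_similarity_embedding psi ->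
  exists2 f, eucl_isometry f & forall x, psi x = f (phi x).
Proof.
move=> X_posdef emb_phi emb_psi.
pose A (chi : X -> 'rV[R]_(#|X|.-1)) := \matrix_k (chi (vertex k) - chi x0).
have AE chi : is_similarity_embedding chi -> A chi *m (A chi)^T = based_gram_mx.
  move=> emb; apply/matrixP => k l.
  rewrite [RHS]mxE -(embedding_based_gram _ _ emb).
  by rewrite dotE mxE; apply: eq_bigr => i _; rewrite !mxE.
have Au : A phi \in unitmx.
  have := posdefmx_unit (based_gram_mx_posdef X_posdef).
  by rewrite -(AE _ emb_phi) unitmx_mul => /andP[].
have AA : A phi *m (A phi)^T = A psi *m (A psi)^T by rewrite !AE.
have [f f_iso [f0 fv]] := congruent_frames_isometry (phi x0) (psi x0) Au AA.
exists f => // x; have [->//|[k ->]] := vertexP x.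
by have := fv k; rewrite !rowK ![_ x0 + _]addrC !subrK.
Qed.

End Simplex.

(** * The magnitude formula characterizes the similarity embedding *)

Lemma similarity_embedding_formula (R : realType) (X : finMetricType R)
    (phi : X -> 'rV[R]_(#|X|.-1)) :
  positive_definite_space X -> is_similarity_embedding phi ->
  magnitude_circumradius_formula phi.
Proof.
move=> X_posdef emb Y Y0; split; first exact: embedding_affinely_independent.
rewrite (circumradius_embedding emb X_posdef Y0).
have m0 : magnitude Y != 0 by rewrite gt_eqF ?magnitude_gt0.
by rewrite -[LHS]invrK div1r; congr (_^-1); field.
Qed.

(** The formula at the subspace [{x, y}] equates the two circumradii of this pair
    with each other, and each of them is half a distance. *)
Lemma formula_dist (R : realType) (X : finMetricType R)
    (phi psi : X -> 'rV[R]_(#|X|.-1)) x y :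
  injective phi -> injective psi ->
  magnitude_circumradius_formula phi -> magnitude_circumradius_formula psi ->
  eucl_norm (phi x - phi y) ^+ 2 = eucl_norm (psi x - psi y) ^+ 2.
Proof.
move=> phi_inj psi_inj Fphi Fpsi.
have [->|xy] := eqVneq x y; first by rewrite !subrr.
have Y0 : [set x; y]%SET != finset.set0.
  by apply/set0Pn; exists x; rewrite !inE eqxx.
have := (Fpsi _ Y0).2; rewrite (Fphi _ Y0).2 !div1r => /invr_inj.
rewrite !circumradius_pair//; lra.
Qed.

Theorem theorem2p15 (R : realType) (X : finMetricType R)
    (X_nonempty : (0 < #|X|)%N) (X_posdef : positive_definite_space X) :
  (exists phi : X -> 'rV[R]_(#|X|.-1), is_similarity_embedding phi) /\
  (forall phi : X -> 'rV[R]_(#|X|.-1), is_similarity_embedding phi ->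
     [/\ injective phi,
         magnitude_circumradius_formula phi
       & forall psi : X -> 'rV[R]_(#|X|.-1),
           injective psi -> magnitude_circumradius_formula psi ->
           exists2 f : 'rV[R]_(#|X|.-1) -> 'rV[R]_(#|X|.-1),
             eucl_isometry f & forall x, psi x = f (phi x)]).
Proof.
have [x0 _] : exists x0 : X, x0 \in X by apply/card_gt0P.
split=> [|phi emb]; first exact: similarity_embedding_exists.
have phi_inj := embedding_inj emb.
have Fphi := similarity_embedding_formula X_posdef emb.
split=> // psi psi_inj Fpsi.
apply: (similarity_embeddings_isometric x0) => // x y.
by rewrite -(formula_dist x y phi_inj psi_inj Fphi Fpsi).
Qed.
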